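(* For every $j\in\{1,2,3,4\}$ the following are chains of groups (under matrix multiplication) of complex orthogonal matrices, where $\le$ means ''is a subgroup of'': 1. $\{I\}\le P_{(34)}\mathcal{X}_3\le P_{(34)}\mathcal{X}_3\cup P_{(34)}\mathcal{X}_j\le P_{(34)}\mathcal{X}_3\cup P_{(34)}\mathcal{X}_j\cup\mathcal{X}_3\cup\mathcal{X}_j\le\mathcal{O}_4$, and $\{I\}\le P_{(34)}\mathcal{X}_3\le P_{(34)}\mathcal{X}_3\cup\mathcal{X}_j\le P_{(34)}\mathcal{X}_3\cup P_{(34)}\mathcal{X}_j\cup\mathcal{X}_3\cup\mathcal{X}_j\le\mathcal{O}_4$; 2. $\{I\}\le P_{(24)}\mathcal{Y}_3\le P_{(24)}\mathcal{Y}_3\cup P_{(24)}\mathcal{Y}_j\le P_{(24)}\mathcal{Y}_3\cup P_{(24)}\mathcal{Y}_j\cup\mathcal{Y}_3\cup\mathcal{Y}_j\le\mathcal{O}_4$, and $\{I\}\le P_{(24)}\mathcal{Y}_3\le P_{(24)}\mathcal{Y}_3\cup\mathcal{Y}_j\le P_{(24)}\mathcal{Y}_3\cup P_{(24)}\mathcal{Y}_j\cup\mathcal{Y}_3\cup\mathcal{Y}_j\le\mathcal{O}_4$; 3. $\{I\}\le P_{(23)}\mathcal{Z}_3\le P_{(23)}\mathcal{Z}_3\cup P_{(23)}\mathcal{Z}_j\le P_{(23)}\mathcal{Z}_3\cup P_{(23)}\mathcal{Z}_j\cup\mathcal{Z}_3\cup\mathcal{Z}_j\le\mathcal{O}_4$,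 and $\{I\}\le P_{(23)}\mathcal{Z}_3\le P_{(23)}\mathcal{Z}_3\cup\mathcal{Z}_j\le P_{(23)}\mathcal{Z}_3\cup P_{(23)}\mathcal{Z}_j\cup\mathcal{Z}_3\cup\mathcal{Z}_j\le\mathcal{O}_4$.
   Context: $\mathcal{O}_4$ is the group of complex $4\times4$ matrices $A$ with $A^TA=I$. For a permutation $\sigma$, $P_\sigma$ is the permutation matrix with $(i,j)$ entry $1$ if $\sigma(i)=j$ and $0$ otherwise. For a matrix $P$ and a set $\mathcal{S}$ of matrices, $P\mathcal{S}=\{PD:D\in\mathcal{S}\}$. For complex $t,x,z$ and a sign $\pm$: $$A_t=\begin{bmatrix}t&-t\\-t&t\end{bmatrix},\quad B^{\pm}_t=\begin{bmatrix}t&\pm1-t\\ \pm1-t&t\end{bmatrix},\quad F=\begin{bmatrix}0&1\\1&0\end{bmatrix},$$ $$M^{\pm}_{x,z}=\begin{bmatrix}A_x&B^{\pm}_z\\ B^{\pm}_z&-A_x\end{bmatrix},\quad N^{\pm}_{x,z}=\begin{bmatrix}B^{\pm}_x&A_z\\ A_z&FB^{\pm}_x\end{bmatrix}.$$ With $x,z\in\mathbb{C}$: $\mathcal{X}_1=\{M^+_{x,z}:x^2+z^2-z=0\}$, $\mathcal{X}_2=\{M^-_{x,z}:x^2+z^2+z=0\}$, $\mathcal{X}_3=\{N^+_{x,z}:x^2+z^2-x=0\}$, $\mathcal{X}_4=\{N^-_{x,z}:x^2+z^2+x=0\}$; and for $j=1,2,3,4$, $\mathcal{Y}_j=\{P_{(23)}DP_{(23)}:D\in\mathcal{X}_j\}$,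 $\mathcal{Z}_j=\{P_{(24)}DP_{(24)}:D\in\mathcal{X}_j\}$. *)

(* Defs.v *)
From mathcomp Require Import all_boot all_order all_fingroup all_algebra.
From mathcomp Require Import classical_sets reals.
From mathcomp Require Import complex.

Set Implicit Arguments.
Unset Strict Implicit.
Unset Printing Implicit Defensive.

Import GRing.Theory.

Local Open Scope classical_set_scope.
Local Open Scope complex_scope.
Local Open Scope ring_scope.

Section MatrixGroups.
Variables (K : comNzRingType) (n : nat).
Implicit Types G H : set 'M[K]_n.

(* The neutral element is not required to be the identity matrix, although
   this is forced for every group that has [set 1%:M] as a subgroup. *)
Definition matrix_group G : Prop :=
  (forall A B, G A -> G B -> G (A *m B)) /\
  exists2 E, G E & forall A, G A ->
    [/\ E *m A = A, A *m E = A &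
        exists2 B, G B & A *m B = E /\ B *m A = E].

Definition subgroup H G : Prop :=
  [/\ matrix_group H, matrix_group G & H `<=` G].

Definition subgroup_chain (G0 G1 G2 G3 G4 : set 'M[K]_n) : Prop :=
  [/\ subgroup G0 G1, subgroup G1 G2, subgroup G2 G3 & subgroup G3 G4].

(* The bilinear condition: plain transpose, no conjugation. *)
Definition orthogonal_group : set 'M[K]_n := [set A | A^T *m A = 1%:M].

Definition lmulset (P : 'M[K]_n) (S : set 'M[K]_n) : set 'M[K]_n :=
  [set P *m D | D in S].

Definition conjset (P : 'M[K]_n) (S : set 'M[K]_n) : set 'M[K]_n :=
  [set P *m D *m P | D in S].

End MatrixGroups.

Arguments orthogonal_group : clear implicits.

Section Families.
Variable R : realType.
Local Notation C := R[i].

(* The matrix P_(a b) of a transposition; a and b are 1-based, in {1,..,4}.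
   The (i, j) entry of perm_mx s is (s i == j)%:R. *)
Definition Ptr (a b : nat) : 'M[C]_4 :=
  perm_mx (tperm (inord a.-1) (inord b.-1)).

Definition mx2 (a b c d : C) : 'M[C]_2 :=
  \matrix_(i < 2, j < 2) nth 0 (nth [::] [:: [:: a; b]; [:: c; d]] i) j.

Definition mxA (t : C) : 'M[C]_2 := mx2 t (- t) (- t) t.

(* In mxB, mxM and mxN, the argument s is the sign, 1 or -1. *)
Definition mxB (s t : C) : 'M[C]_2 := mx2 t (s - t) (s - t) t.

Definition mxF : 'M[C]_2 := mx2 0 1 1 0.

Definition mxM (s x z : C) : 'M[C]_4 :=
  block_mx (mxA x) (mxB s z) (mxB s z) (- mxA x) : 'M[C]_(2 + 2).

Definition mxN (s x z : C) : 'M[C]_4 :=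
  block_mx (mxB s x) (mxA z) (mxA z) (mxF *m mxB s x) : 'M[C]_(2 + 2).

(* Indexed by j = 1, .., 4; the value outside this range is irrelevant. *)
Definition calX (j : nat) : set 'M[C]_4 :=
  match j with
  | 1 => [set D | exists x z : C, x ^+ 2 + z ^+ 2 - z = 0 /\ D = mxM 1 x z]
  | 2 => [set D | exists x z : C, x ^+ 2 + z ^+ 2 + z = 0 /\ D = mxM (- 1) x z]
  | 3 => [set D | exists x z : C, x ^+ 2 + z ^+ 2 - x = 0 /\ D = mxN 1 x z]
  | 4 => [set D | exists x z : C, x ^+ 2 + z ^+ 2 + x = 0 /\ D = mxN (- 1) x z]
  | _ => set0
  end.

Definition calY (j : nat) : set 'M[C]_4 := conjset (Ptr 2 3) (calX j).

Definition calZ (j : nat) : set 'M[C]_4 := conjset (Ptr 2 4) (calX j).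

End Families.

Arguments calX : clear implicits.
Arguments calY : clear implicits.
Arguments calZ : clear implicits.

(* Main.v *)
Require Import Defs.
From mathcomp Require Import all_boot all_order all_fingroup all_algebra.
From mathcomp Require Import classical_sets reals.
From mathcomp Require Import complex.
From mathcomp Require Import ring.

(**
With e = (1, 1) and f = (1, -1), the space C^4 = C^2 (x) C^2 splits into
C^2 (x) e and C^2 (x) f.  Every matrix of the theorem preserves this splitting:
X_j consists of the matrices that act on the first summand by a fixed symmetric
involution g_j (respectively F, -F, I, -I) and on the second one by an
arbitrary element of O_2 of determinant -1, while P_(34) acts by I on the first
summand and by diag(1, -1) on the second.  So each set of the first item is
described by the pairs (first block, determinant of the second block) it
allows, and these pairs form subgroups of {I, g_j} x {1, -1}.  Conjugation by
P_(23) and P_(24) carries the first item to the other two.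
*)

Import GRing.Theory.

Local Open Scope classical_set_scope.
Local Open Scope complex_scope.
Local Open Scope ring_scope.

(** * Groups of orthogonal matrices and their conjugates *)

Section MatrixGroups.
Variables (K : comUnitRingType) (n : nat).
Implicit Types (G H S : set 'M[K]_n) (P Q : 'M[K]_n).

(** The transpose serves as the inverse: [A^T *m A = 1%:M] also gives [A *m A^T = 1%:M] for square
    matrices. *)
Lemma matrix_group_orthogonal G :
    G `<=` orthogonal_group K n -> G 1%:M ->
    (forall A B, G A -> G B -> G (A *m B)) -> (forall A, G A -> G A^T) ->
  matrix_group G.
Proof.
move=> GO G1 GM GT; split=> //; exists 1%:M => // A GA.
have AtA : A^T *m A = 1%:M by exact: GO.
rewrite mul1mx mulmx1; split=> //; exists A^T; first exact: GT.
by split; first exact: mulmx1C.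
Qed.

Lemma matrix_group_orthogonal_group : matrix_group (orthogonal_group K n).
Proof.
apply: matrix_group_orthogonal => //.
- by rewrite /orthogonal_group /= trmx1 mul1mx.
- move=> A B AO BO; rewrite /orthogonal_group /= trmx_mul.
  by rewrite -mulmxA (mulmxA A^T) AO mul1mx.
- by move=> A AO; rewrite /orthogonal_group /= trmxK; apply: mulmx1C.
Qed.

(** Inserting [P *m P] gives PQDP = (PQP)(PDP). This is how a coset of X_j becomes one of Y_j or
    Z_j. *)
Lemma conjset_lmulset P Q S : P *m P = 1%:M ->
  conjset P (lmulset Q S) = lmulset (P *m Q *m P) (conjset P S).
Proof.
move=> PP; rewrite /conjset /lmulset !image_comp; apply: eq_imagel => A _ /=.
by rewrite !mulmxA -(mulmxA _ P P) PP mulmx1.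
Qed.

Lemma conjset1 P : P *m P = 1%:M -> conjset P [set 1%:M] = [set 1%:M].
Proof. by move=> PP; rewrite /conjset image_set1 mulmx1 PP. Qed.

Section Conjugation.
Variable P : 'M[K]_n.
Hypotheses (PP : P *m P = 1%:M) (PT : P^T = P).

Lemma conjmxM A B : P *m A *m P *m (P *m B *m P) = P *m (A *m B) *m P.
Proof. by rewrite !mulmxA -(mulmxA _ P P) PP mulmx1. Qed.

Lemma conjmxK A : P *m (P *m A *m P) *m P = A.
Proof. by rewrite !mulmxA PP mul1mx -mulmxA PP mulmx1. Qed.

Lemma conjset_orthogonal_group :
  conjset P (orthogonal_group K n) = orthogonal_group K n.
Proof.
have conjO A : orthogonal_group K n A -> orthogonal_group K n (P *m A *m P).
  move=> AO; rewrite /orthogonal_group /= !trmx_mul PT mulmxA conjmxM AO.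
  by rewrite mulmx1.
apply/seteqP; split=> [_ [A AO <-]|A AO]; first exact: conjO.
by exists (P *m A *m P); [exact: conjO | exact: conjmxK].
Qed.

Lemma matrix_group_conjset G : matrix_group G -> matrix_group (conjset P G).
Proof.
move=> [GM [E GE Einv]]; split.
  by move=> _ _ [A GA <-] [B GB <-]; rewrite conjmxM; exists (A *m B); auto.
exists (P *m E *m P); first by exists E.
move=> _ [A GA <-]; have [EA AE [B GB [AB BA]]] := Einv A GA.
rewrite !conjmxM EA AE; split=> //; exists (P *m B *m P); first by exists B.
by rewrite !conjmxM AB BA.
Qed.

Lemma subgroup_conjset H G :
  subgroup H G -> subgroup (conjset P H) (conjset P G).
Proof.
by case=> *; split; [exact: matrix_group_conjset.. | exact: image_subset].
Qed.

Lemma subgroup_chain_conjset G1 G2 G3 :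
  subgroup_chain [set 1%:M] G1 G2 G3 (orthogonal_group K n) ->
  subgroup_chain [set 1%:M] (conjset P G1) (conjset P G2) (conjset P G3)
    (orthogonal_group K n).
Proof.
(* Both ends of the chain are stable under conjugation; only those of the conclusion are rewritten
   as conjugates. *)
rewrite -{2}(conjset1 _ PP) -{2}conjset_orthogonal_group.
by case=> *; split; exact: subgroup_conjset.
Qed.

End Conjugation.
End MatrixGroups.

(** * Arithmetic of explicit 2 x 2 matrices *)

Section Splitting.
Variable R : realType.
Local Notation C := R[i].
Implicit Types (E Q : 'M[C]_2) (L : set ('M[C]_2 * C)).

Lemma mx2P (A : 'M[C]_2) : A = mx2 (A 0 0) (A 0 1) (A 1 0) (A 1 1).
Proof.
apply/matrixP => -[[|[|//]] ?] [[|[|//]] ?]; rewrite mxE /=; congr (A _ _);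
  exact: val_inj.
Qed.

Lemma mx2E (a b c d : C) :
  (mx2 a b c d 0 0 = a) * (mx2 a b c d 0 1 = b) *
  (mx2 a b c d 1 0 = c) * (mx2 a b c d 1 1 = d).
Proof. by rewrite !mxE. Qed.

Lemma mx2_inj (a b c d a' b' c' d' : C) :
  mx2 a b c d = mx2 a' b' c' d' -> [/\ a = a', b = b', c = c' & d = d'].
Proof.
by move=> eq_mx; split; [move/matrixP: eq_mx => /(_ 0 0)
  | move/matrixP: eq_mx => /(_ 0 1) | move/matrixP: eq_mx => /(_ 1 0)
  | move/matrixP: eq_mx => /(_ 1 1)]; rewrite !mx2E.
Qed.

Lemma mulmx2 (a b c d a' b' c' d' : C) :
  mx2 a b c d *m mx2 a' b' c' d' =
  mx2 (a * a' + b * c') (a * b' + b * d') (c * a' + d * c') (c * b' + d * d').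
Proof.
have lift01 : lift ord0 ord0 = 1 :> 'I_2 by apply: val_inj.
by rewrite [LHS]mx2P !mxE !big_ord_recl !big_ord0 !addr0 lift01 !mx2E.
Qed.

Lemma addmx2 (a b c d a' b' c' d' : C) :
  mx2 a b c d + mx2 a' b' c' d' = mx2 (a + a') (b + b') (c + c') (d + d').
Proof. by rewrite [LHS]mx2P !mxE. Qed.

Lemma oppmx2 (a b c d : C) : - mx2 a b c d = mx2 (- a) (- b) (- c) (- d).
Proof. by rewrite [LHS]mx2P !mxE. Qed.

Lemma trmx2 (a b c d : C) : (mx2 a b c d)^T = mx2 a c b d.
Proof. by rewrite [LHS]mx2P !mxE. Qed.

Lemma mx2_1 : 1%:M = mx2 1 0 0 1 :> 'M[C]_2.
Proof. by rewrite [LHS]mx2P !mxE. Qed.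

Lemma det_mx2 (a b c d : C) : \det (mx2 a b c d) = a * d - b * c.
Proof. have lift01 : lift ord0 ord0 = 1 :> 'I_2 by apply: val_inj.
have lift10 : lift 1 ord0 = 0 :> 'I_2 by apply: val_inj.
rewrite (expand_det_row _ 0) !big_ord_recl big_ord0 /cofactor !det_mx11 !mxE.
by rewrite lift01 lift10 /=; ring. Qed.

Lemma mulmx2E (A B : 'M[C]_2) i k : (A *m B) i k = A i 0 * B 0 k + A i 1 * B 1 k.
Proof.
have lift01 : lift ord0 ord0 = 1 :> 'I_2 by apply: val_inj.
by rewrite !mxE !big_ord_recl big_ord0 addr0 lift01.
Qed.

(** * Matrices that preserve the splitting, and sets of them *)

(* The matrix with eigenvalue p on e = (1, 1) and q on f = (1, -1). *)
Definition eigmx (p q : C) : 'M[C]_2 :=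
  mx2 ((p + q) / 2) ((p - q) / 2) ((p - q) / 2) ((p + q) / 2).

Lemma eigmxM p q p' q' : eigmx p q *m eigmx p' q' = eigmx (p * p') (q * q').
Proof. by rewrite /eigmx mulmx2; congr mx2; field. Qed.

Lemma eigmxD p q p' q' : eigmx p q + eigmx p' q' = eigmx (p + p') (q + q').
Proof. by rewrite /eigmx addmx2; congr mx2; field. Qed.

Lemma eigmx_tr p q : (eigmx p q)^T = eigmx p q.
Proof. exact: trmx2. Qed.

Lemma eigmx1 : eigmx 1 1 = 1%:M.
Proof. by rewrite /eigmx mx2_1; congr mx2; field. Qed.

Lemma eigmx0 : eigmx 0 0 = 0.
Proof. by rewrite /eigmx [RHS]mx2P !mxE; congr mx2; field. Qed.

(* The matrix acting by E on C^2 (x) e and by Q on C^2 (x) f. *)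
Definition splitmx E Q : 'M[C]_4 :=
  block_mx (eigmx (E 0 0) (Q 0 0)) (eigmx (E 0 1) (Q 0 1))
           (eigmx (E 1 0) (Q 1 0)) (eigmx (E 1 1) (Q 1 1)) : 'M[C]_(2 + 2).

(** All blocks are diagonal in the common basis e, f, so block multiplication proceeds separately on
    the eigenvalues at e and at f. *)
Lemma splitmxM E Q E' Q' :
  splitmx E Q *m splitmx E' Q' = splitmx (E *m E') (Q *m Q').
Proof.
rewrite /splitmx !(mulmx2E E) !(mulmx2E Q) -!eigmxD -!eigmxM.
exact: (@mulmx_block _ 2 2 2 2 2 2).
Qed.

Lemma splitmx_tr E Q : (splitmx E Q)^T = splitmx E^T Q^T.
Proof.
by rewrite /splitmx [LHS](@tr_block_mx _ 2 2 2 2) !eigmx_tr !mxE.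
Qed.

Lemma splitmx1 : splitmx 1%:M 1%:M = 1%:M.
Proof.
rewrite /splitmx !mxE /= eigmx1 eigmx0.
by apply: esym; apply: (@scalar_mx_block _ 2 2).
Qed.

(** [L] prescribes the pairs (action on C^2 (x) e, determinant on C^2 (x) f); apart from its
    determinant, [Q] ranges over all of O_2. *)
Definition splitset L : set 'M[C]_4 :=
  [set A | exists E Q, [/\ Q^T *m Q = 1%:M, L (E, \det Q) & A = splitmx E Q]].

Lemma splitsetU L L' : splitset (L `|` L') = splitset L `|` splitset L'.
Proof.
apply/seteqP; split=> A.
  by case=> E [Q [QO [LE|LE] AE]]; [left | right]; exists E, Q.
by case=> -[E [Q [QO LE AE]]]; exists E, Q; split=> //; [left | right].
Qed.

(** These conditions make [splitset L] a group of orthogonal matrices: transposing [splitmx E Q]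
    fixes both [E] and the determinant of [Q], so inverses stay in the set. *)
Definition admissible L :=
  [/\ L (1%:M, 1), forall p q, L p -> L q -> L (p.1 *m q.1, p.2 * q.2) &
      forall p, L p -> p.1^T = p.1 /\ p.1 *m p.1 = 1%:M].

Lemma splitset_sub_orthogonal L :
  admissible L -> splitset L `<=` orthogonal_group C 4.
Proof.
case=> _ _ Linv _ [E [Q [QO LE ->]]]; have /= [ET EE] := Linv _ LE.
by rewrite /orthogonal_group /= splitmx_tr splitmxM ET EE QO splitmx1.
Qed.

Lemma matrix_group_splitset L : admissible L -> matrix_group (splitset L).
Proof.
move=> Ladm; have [L1 LM Linv] := Ladm; apply: matrix_group_orthogonal.
- exact: splitset_sub_orthogonal.
- by exists 1%:M, 1%:M; rewrite trmx1 mul1mx det1 splitmx1.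
- move=> _ _ [E [Q [QO LE ->]]] [E' [Q' [QO' LE' ->]]].
  exists (E *m E'), (Q *m Q'); rewrite splitmxM det_mulmx; split=> //.
    by rewrite trmx_mul -mulmxA (mulmxA Q^T) QO mul1mx.
  exact: (LM _ _ LE LE').
- move=> _ [E [Q [QO LE ->]]]; have /= [ET _] := Linv _ LE.
  exists E, Q^T; rewrite splitmx_tr ET det_tr trmxK; split=> //.
  exact: mulmx1C.
Qed.

Lemma subgroup_splitset L L' :
  admissible L -> admissible L' -> L `<=` L' ->
  subgroup (splitset L) (splitset L').
Proof.
move=> adL adL' LL'; split; [exact: matrix_group_splitset.. |].
by move=> _ [E [Q [QO LE ->]]]; exists E, Q; split=> //; apply: LL'.
Qed.

Lemma subgroup_chain_splitset L L' L'' :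
    admissible L -> admissible L' -> admissible L'' -> L `<=` L' -> L' `<=` L'' ->
  subgroup_chain [set 1%:M] (splitset L) (splitset L') (splitset L'')
    (orthogonal_group C 4).
Proof.
move=> adL adL' adL'' LL' LL''; split.
- split; last by move=> _ ->; exists 1%:M, 1%:M;
    rewrite trmx1 mul1mx det1 splitmx1; split=> //; case: adL.
    apply: matrix_group_orthogonal => //.
    + by move=> _ ->; rewrite /orthogonal_group /= trmx1 mul1mx.
    + by move=> _ _ -> ->; rewrite mul1mx.
    + by move=> _ ->; rewrite /= trmx1.
  exact: matrix_group_splitset.
- exact: subgroup_splitset.
- exact: subgroup_splitset.
- split; [exact: matrix_group_splitset | exact: matrix_group_orthogonal_group |].
  exact: splitset_sub_orthogonal.
Qed.

(** The largest label set is {1, E} x {1, -1}; the two middle terms come from its subgroups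
    generated by (E, 1) and by (E, -1). *)
Lemma subgroup_chains_involution E : E^T = E -> E *m E = 1%:M ->
  let S E d := splitset [set (E, d)] in
  subgroup_chain [set 1%:M] (S 1%:M 1) (S 1%:M 1 `|` S E 1)
    (S 1%:M 1 `|` S E 1 `|` S 1%:M (-1) `|` S E (-1)) (orthogonal_group C 4) /\
  subgroup_chain [set 1%:M] (S 1%:M 1) (S 1%:M 1 `|` S E (-1))
    (S 1%:M 1 `|` S E 1 `|` S 1%:M (-1) `|` S E (-1)) (orthogonal_group C 4).
Proof.
move=> ET EE S; rewrite /S -!splitsetU.
have adm L : L (1%:M, 1) ->
    (forall p q, L p -> L q -> L (p.1 *m q.1, p.2 * q.2)) ->
    (forall p, L p -> p.1 = 1%:M \/ p.1 = E) -> admissible L.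
  move=> L1 LM LE; split=> // p /LE[] ->; last by [].
  by rewrite trmx1 mul1mx.
have simpE := (EE, mul1mx, mulmx1, mulrNN, mul1r, mulr1).
have adm1 : admissible [set (1%:M, 1)].
  by apply: adm => [|p q -> ->|p ->]; rewrite /= ?simpE; auto.
have adm2 d : d * d = 1 -> admissible ([set (1%:M, 1)] `|` [set (E, d)]).
  move=> dd; apply: adm => [|p q [->|->] [->|->]|p [->|->]];
    rewrite /= ?simpE ?dd; auto.
have adm4 : admissible ([set (1%:M, 1)] `|` [set (E, 1)] `|`
    [set (1%:M, -1)] `|` [set (E, -1)]).
  apply: adm => [|p q [[[->|->]|->]|->] [[[->|->]|->]|->]|p [[[->|->]|->]|->]];
    rewrite /= ?simpE; auto 6.
split; apply: subgroup_chain_splitset => //.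
- exact: adm2 (mulr1 1).
- by move=> p /=; tauto.
- by apply: adm2; rewrite mulrNN mulr1.
- by move=> p /=; tauto.
Qed.

(** * The families X_j in split form *)

(** With determinant -1, Q^T is the inverse of Q, which is minus its adjugate; comparing entries
    gives c = b and d = -a. *)
Lemma orthogonal_detN1 (Q : 'M[C]_2) :
  Q^T *m Q = 1%:M /\ \det Q = -1 <->
  exists a b, a ^+ 2 + b ^+ 2 = 1 /\ Q = mx2 a b b (- a).
Proof.
split=> [|[a [b [ab1 ->]]]]; last first.
  rewrite trmx2 mulmx2 mx2_1 det_mx2; split; last by rewrite -ab1; ring.
  by congr mx2; rewrite -?ab1; ring.
rewrite (mx2P Q); move: (Q 0 0) (Q 0 1) (Q 1 0) (Q 1 1) => a b c d.
rewrite trmx2 mulmx2 mx2_1 det_mx2 => -[/mx2_inj[ac1 abcd _ bd1] detN].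
(* The difference is a combination of three vanishing expressions: the determinant relation and the
   first row of Q^T Q = I. The next identity has the same shape. *)
have /eqP Ec : c == b.
  rewrite -subr_eq0 (_ : c - b = c * (a * d - b * c + 1) - a * (a * b + c * d)
    + b * (a * a + c * c - 1)); last by ring.
  by rewrite detN abcd ac1 addNr subrr !mulr0 subrr addr0.
have /eqP Ed : d == - a.
  rewrite -addr_eq0 (_ : d + a = a * (a * d - b * c + 1) + c * (a * b + c * d)
    - d * (a * a + c * c - 1)); last by ring.
  by rewrite detN abcd ac1 addNr subrr !mulr0 addr0 subr0.
by exists a, b; rewrite Ed Ec -ac1 Ec; split=> //; ring.
Qed.

Lemma splitset_detN1 E : splitset [set (E, -1)] =
  [set A | exists a b, a ^+ 2 + b ^+ 2 = 1 /\ A = splitmx E (mx2 a b b (- a))].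
Proof.
apply/seteqP; split=> A /=.
  move=> [_ [Q [QO [-> detQ] ->]]].
  by have [a [b [ab1 ->]]] := (orthogonal_detN1 Q).1 (conj QO detQ); exists a, b.
move=> [a [b [ab1 ->]]]; exists E, (mx2 a b b (- a)).
have [|QO ->] := (orthogonal_detN1 (mx2 a b b (- a))).2; last by split.
by exists a, b.
Qed.

(** On e and f, A_t has eigenvalues 0 and 2t, and B_t has s and 2t - s. *)
Lemma mxM_split s x z : mxM s x z =
  splitmx (mx2 0 s s 0) (mx2 (2 * x) (2 * z - s) (2 * z - s) (- (2 * x))).
Proof.
rewrite /mxM /splitmx !mx2E /mxA /mxB /eigmx oppmx2.
by congr (block_mx (mx2 _ _ _ _) (mx2 _ _ _ _) (mx2 _ _ _ _) (mx2 _ _ _ _));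
  field.
Qed.

(** Since F fixes e and negates f, F B_x has eigenvalues s and -(2x - s). *)
Lemma mxN_split s x z : mxN s x z =
  splitmx (mx2 s 0 0 s) (mx2 (2 * x - s) (2 * z) (2 * z) (- (2 * x - s))).
Proof.
rewrite /mxN /splitmx !mx2E /mxA /mxB /mxF /eigmx mulmx2.
by congr (block_mx (mx2 _ _ _ _) (mx2 _ _ _ _) (mx2 _ _ _ _) (mx2 _ _ _ _));
  field.
Qed.

(** With a = 2x and b = 2z - s, a^2 + b^2 - 1 is four times the defining polynomial, as s^2 = 1. The
    parameter [c] lets the equations for both signs match as they are written. *)
Lemma mxM_splitset s (c : C -> C -> C) :
    s * s = 1 -> (forall x z, c x z = x ^+ 2 + z ^+ 2 - s * z) ->
  [set D | exists x z, c x z = 0 /\ D = mxM s x z] =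
  splitset [set (mx2 0 s s 0, -1)].
Proof.
move=> ss cE; rewrite splitset_detN1; apply/seteqP; split=> D /=.
  move=> [x [z [cxz ->]]]; exists (2 * x), (2 * z - s); rewrite mxM_split.
  split=> //; transitivity (4 * c x z + s * s); first by rewrite cE; ring.
  by rewrite cxz ss mulr0 add0r.
(* The witnesses invert the substitution a = 2x, b = 2z - s. *)
move=> [a [b [ab1 ->]]]; exists (a / 2), ((b + s) / 2); rewrite mxM_split.
split; last by congr splitmx; congr mx2; field.
transitivity ((a ^+ 2 + b ^+ 2 - s * s) / 4); first by rewrite cE; field.
by rewrite ab1 ss subrr mul0r.
Qed.

Lemma mxN_splitset s (c : C -> C -> C) :
    s * s = 1 -> (forall x z, c x z = x ^+ 2 + z ^+ 2 - s * x) ->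
  [set D | exists x z, c x z = 0 /\ D = mxN s x z] =
  splitset [set (mx2 s 0 0 s, -1)].
Proof.
move=> ss cE; rewrite splitset_detN1; apply/seteqP; split=> D /=.
  move=> [x [z [cxz ->]]]; exists (2 * x - s), (2 * z); rewrite mxN_split.
  split=> //; transitivity (4 * c x z + s * s); first by rewrite cE; ring.
  by rewrite cxz ss mulr0 add0r.
move=> [a [b [ab1 ->]]]; exists ((a + s) / 2), (b / 2); rewrite mxN_split.
split; last by congr splitmx; congr mx2; field.
transitivity ((a ^+ 2 + b ^+ 2 - s * s) / 4); first by rewrite cE; field.
by rewrite ab1 ss subrr mul0r.
Qed.

Lemma calX3_splitset : calX R 3 = splitset [set (1%:M, -1)].
Proof. by rewrite mx2_1; apply: mxN_splitset => [|x z]; rewrite ?mul1r. Qed.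

Lemma calX_splitset j : (1 <= j <= 4)%N -> exists E,
  [/\ E^T = E, E *m E = 1%:M & calX R j = splitset [set (E, -1)]].
Proof.
have N1N1 : -1 * -1 = 1 :> C by rewrite mulrNN mulr1.
case: j => [|[|[|[|[|]]]]] // _.
- exists (mx2 0 1 1 0); rewrite trmx2 mulmx2 mx2_1; split=> //.
    by congr mx2; ring.
  by apply: mxM_splitset => [|x z]; rewrite ?mul1r.
- exists (mx2 0 (-1) (-1) 0); rewrite trmx2 mulmx2 mx2_1; split=> //.
    by congr mx2; ring.
  by apply: mxM_splitset => // x z; rewrite mulN1r opprK.
- by exists 1%:M; rewrite trmx1 mul1mx calX3_splitset.
- exists (mx2 (-1) 0 0 (-1)); rewrite trmx2 mulmx2 mx2_1; split=> //.
    by congr mx2; ring.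
  by apply: mxN_splitset => // x z; rewrite mulN1r opprK.
Qed.

(** * The transposition matrices *)

Lemma Ptr34_splitmx : Ptr R 3 4 = splitmx 1%:M (mx2 1 0 0 (-1)).
Proof.
(* P_(34) is block diagonal with blocks I and F, and F has eigenvalues 1 on e and -1 on f. *)
have -> : splitmx 1%:M (mx2 1 0 0 (-1)) =
    block_mx 1%:M 0 0 (mxF R) :> 'M[C]_(2 + 2).
  rewrite /splitmx !mx2E !mxE /= eigmx1 eigmx0 /eigmx /mxF.
  by congr (block_mx _ _ _ (mx2 _ _ _ _)); field.
have i3E : inord 2 = Ordinal (isT : 2 < 4)%N by apply: val_inj; rewrite /= inordK.
have i4E : inord 3 = Ordinal (isT : 3 < 4)%N by apply: val_inj; rewrite /= inordK.
apply/matrixP => i k; rewrite /Ptr /= i3E i4E !mxE permE /=.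
case: splitP => i' ii'; rewrite mxE; case: splitP => k' kk'; rewrite !mxE;
  move: i k i' k' ii' kk' => -[[|[|[|[|//]]]] ?] -[[|[|[|[|//]]]] ?];
  by move=> -[[|[|//]] ?] -[[|[|//]] ?].
Qed.

(** P_(34) acts by Q -> DQ with D = diag(1, -1), an orthogonal involution of determinant -1; it
    therefore exchanges the two determinant classes of O_2. *)
Lemma lmulset_Ptr34_splitset E :
  lmulset (Ptr R 3 4) (splitset [set (E, -1)]) = splitset [set (E, 1)].
Proof.
set D := mx2 1 0 0 (-1) : 'M[C]_2.
have DT : D^T = D by rewrite /D trmx2.
have DD : D *m D = 1%:M by rewrite /D mulmx2 mx2_1; congr mx2; ring.
have detD : \det D = -1 by rewrite det_mx2; ring.
have mulD Q : Q^T *m Q = 1%:M -> (D *m Q)^T *m (D *m Q) = 1%:M.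
  by move=> QO; rewrite trmx_mul DT mulmxA -(mulmxA _ D D) DD mulmx1.
rewrite /lmulset Ptr34_splitmx -/D; apply/seteqP; split=> A /=.
  move=> [_ [_ [Q [QO [-> detQ] ->]]] <-]; exists E, (D *m Q).
  by rewrite splitmxM mul1mx det_mulmx detD detQ mulrNN mulr1; split=> //; auto.
move=> [_ [Q [QO [-> detQ] ->]]]; exists (splitmx E (D *m Q)).
  by exists E, (D *m Q); rewrite det_mulmx detD detQ mulr1; split=> //; auto.
by rewrite splitmxM mul1mx mulmxA DD mul1mx.
Qed.

Lemma Ptr_tr a b : (Ptr R a b)^T = Ptr R a b.
Proof. by rewrite /Ptr tr_perm_mx tpermV. Qed.

Lemma Ptr_sqr a b : Ptr R a b *m Ptr R a b = 1%:M.
Proof. by rewrite /Ptr -perm_mxM tperm2 perm_mx1. Qed.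

(** Conjugating a transposition gives the transposition of the images of its two points. *)
Lemma Ptr_conj a b c d :
  Ptr R c d *m Ptr R a b *m Ptr R c d =
  perm_mx (tperm (tperm (inord c.-1) (inord d.-1) (inord a.-1))
                 (tperm (inord c.-1) (inord d.-1) (inord b.-1))).
Proof.
rewrite /Ptr -!perm_mxM -tpermJ; congr perm_mx.
by rewrite conjgE tpermV mulgA.
Qed.

Lemma inord4_neq (a b : nat) : (a < 4)%N -> (b < 4)%N -> a != b ->
  inord a != inord b :> 'I_4.
Proof. by move=> a4 b4; rewrite -val_eqE /= !inordK. Qed.

Lemma Ptr23_conj34 : Ptr R 2 3 *m Ptr R 3 4 *m Ptr R 2 3 = Ptr R 2 4.
Proof. by rewrite Ptr_conj /Ptr tpermR tpermD ?inord4_neq. Qed.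

Lemma Ptr24_conj34 : Ptr R 2 4 *m Ptr R 3 4 *m Ptr R 2 4 = Ptr R 2 3.
Proof. by rewrite Ptr_conj /Ptr tpermR tpermD ?inord4_neq // tpermC. Qed.

End Splitting.

Theorem theorem2p4 (R : realType) (j : nat) (hj : (1 <= j <= 4)%N) :
  [/\ (subgroup_chain [set 1%:M]
         (lmulset (Ptr R 3 4) (calX R 3))
         (lmulset (Ptr R 3 4) (calX R 3) `|` lmulset (Ptr R 3 4) (calX R j))
         (lmulset (Ptr R 3 4) (calX R 3) `|` lmulset (Ptr R 3 4) (calX R j) `|`
          calX R 3 `|` calX R j)
         (orthogonal_group R[i] 4) /\
       subgroup_chain [set 1%:M]
         (lmulset (Ptr R 3 4) (calX R 3))
         (lmulset (Ptr R 3 4) (calX R 3) `|` calX R j)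
         (lmulset (Ptr R 3 4) (calX R 3) `|` lmulset (Ptr R 3 4) (calX R j) `|`
          calX R 3 `|` calX R j)
         (orthogonal_group R[i] 4)),
      (subgroup_chain [set 1%:M]
         (lmulset (Ptr R 2 4) (calY R 3))
         (lmulset (Ptr R 2 4) (calY R 3) `|` lmulset (Ptr R 2 4) (calY R j))
         (lmulset (Ptr R 2 4) (calY R 3) `|` lmulset (Ptr R 2 4) (calY R j) `|`
          calY R 3 `|` calY R j)
         (orthogonal_group R[i] 4) /\
       subgroup_chain [set 1%:M]
         (lmulset (Ptr R 2 4) (calY R 3))
         (lmulset (Ptr R 2 4) (calY R 3) `|` calY R j)
         (lmulset (Ptr R 2 4) (calY R 3) `|` lmulset (Ptr R 2 4) (calY R j) `|`
          calY R 3 `|` calY R j)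
         (orthogonal_group R[i] 4)) &
      (subgroup_chain [set 1%:M]
         (lmulset (Ptr R 2 3) (calZ R 3))
         (lmulset (Ptr R 2 3) (calZ R 3) `|` lmulset (Ptr R 2 3) (calZ R j))
         (lmulset (Ptr R 2 3) (calZ R 3) `|` lmulset (Ptr R 2 3) (calZ R j) `|`
          calZ R 3 `|` calZ R j)
         (orthogonal_group R[i] 4) /\
       subgroup_chain [set 1%:M]
         (lmulset (Ptr R 2 3) (calZ R 3))
         (lmulset (Ptr R 2 3) (calZ R 3) `|` calZ R j)
         (lmulset (Ptr R 2 3) (calZ R 3) `|` lmulset (Ptr R 2 3) (calZ R j) `|`
          calZ R 3 `|` calZ R j)
         (orthogonal_group R[i] 4))].
Proof.
have [E [ET EE XE]] := calX_splitset R j hj.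
have [chain1 chain2] : subgroup_chain [set 1%:M]
    (lmulset (Ptr R 3 4) (calX R 3))
    (lmulset (Ptr R 3 4) (calX R 3) `|` lmulset (Ptr R 3 4) (calX R j))
    (lmulset (Ptr R 3 4) (calX R 3) `|` lmulset (Ptr R 3 4) (calX R j) `|`
     calX R 3 `|` calX R j)
    (orthogonal_group R[i] 4) /\
  subgroup_chain [set 1%:M]
    (lmulset (Ptr R 3 4) (calX R 3))
    (lmulset (Ptr R 3 4) (calX R 3) `|` calX R j)
    (lmulset (Ptr R 3 4) (calX R 3) `|` lmulset (Ptr R 3 4) (calX R j) `|`
     calX R 3 `|` calX R j)
    (orthogonal_group R[i] 4).
  rewrite calX3_splitset XE !lmulset_Ptr34_splitset.
  exact: subgroup_chains_involution.
have conjU P (S S' : set 'M[R[i]]_4) :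
    conjset P (S `|` S') = conjset P S `|` conjset P S'.
  exact: image_setU.
split; first by split.
(* Conjugation by P_(23) is pulled out of the cosets and unions, so both chains become conjugates of
   those of the first item; P_(24) does the same for Z. *)
- rewrite /calY -Ptr23_conj34 -!conjset_lmulset ?Ptr_sqr // -!conjU.
  by split; apply: subgroup_chain_conjset; rewrite ?Ptr_sqr ?Ptr_tr.
- rewrite /calZ -Ptr24_conj34 -!conjset_lmulset ?Ptr_sqr // -!conjU.
  by split; apply: subgroup_chain_conjset; rewrite ?Ptr_sqr ?Ptr_tr.
Qed.
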